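(* Let $(M^n,g)$ be a Riemannian manifold with nonnegative sectional curvature. If $(M,g)$ has quarter pinched (i.e. $\tfrac14$-pinched) flag curvature, then $(M,g)$ has nonnegative complex sectional curvature.
   Context: Let $R$ be the curvature tensor, with the convention $R(X,Y,Z,W)=\langle \mathrm{Rm}(X\wedge Y),Z\wedge W\rangle$, so that $R(X,Y,X,Y)$ is the sectional curvature of the plane spanned by orthonormal $X,Y$. Flag curvature: for a nonzero $e\in T_xM$ let $R_e(X,Y)=R(e,X,e,Y)$, a symmetric bilinear form. A manifold with nonnegative sectional curvature has $\lambda$-pinched flag curvature ($0\le\lambda<1$) if for all $x\in M$, all nonzero $e\in T_xM$ and all $X,Y\in T_xM$ orthogonal to $e$ with $|X|=|Y|$ one has $R_e(X,X)\ge \lambda R_e(Y,Y)$. Complex sectional curvature: extend $\mathrm{Rm}$ complex linearly to $\wedge^2(T_xM\otimes\mathbb{C})$ and the inner product $\langle\cdot,\cdot\rangle$ complex bilinearly. $(M,g)$ has nonnegative complex sectional curvature if $R(U,V,\bar U,\bar V)=\langle \mathrm{Rm}(U\wedge V),\overline{U\wedge V}\rangle\ge 0$ for all $x\in M$ and all $U,V\in T_xM\otimes\mathbb{C}$. *)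

(* Defs.v *)
From HB Require Import structures.
From mathcomp Require Import all_boot all_order all_algebra.
From mathcomp Require Import all_classical all_reals.
From mathcomp Require Import topology normedtype derive.
From mathcomp Require Import complex.

Set Implicit Arguments.
Unset Strict Implicit.
Unset Printing Implicit Defensive.

Import Order.TTheory GRing.Theory Num.Theory.
Import numFieldTopology.Exports numFieldNormedType.Exports.

Local Open Scope classical_set_scope.
Local Open Scope ring_scope.

Section SmoothFunctions.
Variables (R : realType) (n : nat).

Definition partial (k : 'I_n) (f : 'rV[R]_n -> R) : 'rV[R]_n -> R :=
  fun y => derive f y (delta_mx 0 k).

(* All iterated partial derivatives of f exist and are continuous at every
   point of U; this is the usual notion of smoothness when U is open. *)
Definition smooth_on (U : set 'rV[R]_n) (f : 'rV[R]_n -> R) : Prop :=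
  forall (s : seq 'I_n) (y : 'rV[R]_n), U y ->
    {for y, continuous (foldr partial f s)} /\
    forall k : 'I_n, derivable (foldr partial f s) y (delta_mx 0 k).

End SmoothFunctions.

(* The values of [coord] outside [cdom], and of [point] outside [ccod], are
   irrelevant. *)
Record chart (R : realType) (n : nat) (M : topologicalType) := Chart {
  cdom : set M;
  ccod : set 'rV[R]_n;
  coord :> M -> 'rV[R]_n;
  point : 'rV[R]_n -> M;
  cdom_open : open cdom;
  ccod_open : open ccod;
  coord_cod : forall x, cdom x -> ccod (coord x);
  point_dom : forall y, ccod y -> cdom (point y);
  coordK : forall x, cdom x -> point (coord x) = x;
  pointK : forall y, ccod y -> coord (point y) = y;
  coord_continuous : forall x, cdom x -> {for x, continuous coord};
  point_continuous : forall y, ccod y -> {for y, continuous point}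
}.

Section ChangeOfCharts.
Variables (R : realType) (n : nat) (M : topologicalType).

Definition transition (c c' : chart R n M) : 'rV[R]_n -> 'rV[R]_n :=
  fun y => c' (point c y).

Definition transition_dom (c c' : chart R n M) : set 'rV[R]_n :=
  [set y | ccod c y /\ cdom c' (point c y)].

End ChangeOfCharts.

Record smoothManifold (R : realType) (n : nat) := SmoothManifold {
  carrier :> topologicalType;
  atlas : set (chart R n carrier);
  carrier_hausdorff : hausdorff_space carrier;
  carrier_second_countable : @second_countable carrier;
  atlas_cover : forall x : carrier, exists2 c, atlas c & cdom c x;
  atlas_smooth : forall c c', atlas c -> atlas c' ->
    forall k : 'I_n,
      smooth_on (transition_dom c c') (fun y => transition c c' y 0 k)
}.

(* [gram c y] is the matrix of g at the point of coordinates y, in the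
   coordinate frame of c.  MathComp's jacobian acts on row vectors on the
   right ('d f y v = v *m jacobian f y), whence the form of [gram_change]. *)
Record riemannianMetric (R : realType) (n : nat) (M : smoothManifold R n) :=
  RiemannianMetric {
  gram : chart R n M -> 'rV[R]_n -> 'M[R]_n;
  gram_smooth : forall c, atlas c -> forall i j : 'I_n,
    smooth_on (ccod c) (fun y => gram c y i j);
  gram_sym : forall c, atlas c -> forall y, ccod c y ->
    (gram c y)^T = gram c y;
  gram_pos : forall c, atlas c -> forall y, ccod c y ->
    forall v : 'rV[R]_n, v != 0 -> 0 < (v *m gram c y *m v^T) 0 0;
  gram_change : forall c c', atlas c -> atlas c' ->
    forall y, transition_dom c c' y ->
      gram c y = jacobian (transition c c') y *m gram c' (transition c c' y)
                 *m (jacobian (transition c c') y)^T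
}.

Section CoordinateCurvature.
Variables (R : realType) (n : nat) (G : 'rV[R]_n -> 'M[R]_n).

(* Gamma^m_{ij}, the Levi-Civita connection of the metric matrix G *)
Definition christoffel (m i j : 'I_n) (y : 'rV[R]_n) : R :=
  2^-1 * \sum_(p < n) invmx (G y) m p *
    (partial i (fun z => G z j p) y + partial j (fun z => G z i p) y
     - partial p (fun z => G z i j) y).

(* R(d_i, d_j) d_k = \sum_l (riemann l i j k) d_l, where
   R(X,Y)Z = nabla_X nabla_Y Z - nabla_Y nabla_X Z - nabla_[X,Y] Z *)
Definition riemann (l i j k : 'I_n) (y : 'rV[R]_n) : R :=
  partial i (christoffel l j k) y - partial j (christoffel l i k) y
  + \sum_(m < n) (christoffel m j k y * christoffel l i m y
                  - christoffel m i k y * christoffel l j m y).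

(* R(d_i, d_j, d_k, d_l) = <R(d_i, d_j) d_l, d_k>: with this order of the last
   two arguments R(X, Y, X, Y) is the sectional curvature of an orthonormal
   pair, as on the round sphere, where it is positive. *)
Definition curv_coef (y : 'rV[R]_n) (i j k l : 'I_n) : R :=
  \sum_(m < n) G y k m * riemann m i j l y.

End CoordinateCurvature.

Definition multilin4 (K : pzRingType) (n : nat)
    (T : 'I_n -> 'I_n -> 'I_n -> 'I_n -> K) (U V W Z : 'rV[K]_n) : K :=
  \sum_(i < n) \sum_(j < n) \sum_(k < n) \sum_(l < n)
    T i j k l * U 0 i * V 0 j * W 0 k * Z 0 l.

(* T_x M and its complexification are represented, in each chart c of the atlas
   around x, by the row vectors of components in the coordinate frame of c. *)
Section Curvature.
Variables (R : realType) (n : nat) (M : smoothManifold R n).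
Variable (g : riemannianMetric M).

Definition inner (c : chart R n M) (x : M) (X Y : 'rV[R]_n) : R :=
  (X *m gram g c (c x) *m Y^T) 0 0.

Definition curv (c : chart R n M) (x : M) (X Y Z W : 'rV[R]_n) : R :=
  multilin4 (curv_coef (gram g c) (c x)) X Y Z W.

Definition flag_form (c : chart R n M) (x : M) (e X Y : 'rV[R]_n) : R :=
  curv c x e X e Y.

Definition curvC (c : chart R n M) (x : M) (U V W Z : 'rV[R[i]]_n) : R[i] :=
  multilin4 (fun i j k l => (curv_coef (gram g c) (c x) i j k l)%:C%C) U V W Z.

Definition conj_vec (U : 'rV[R[i]]_n) : 'rV[R[i]]_n := map_mx (@conjc R) U.

Definition nonneg_sectional_curvature : Prop :=
  forall (x : M) (c : chart R n M), atlas c -> cdom c x ->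
  forall X Y : 'rV[R]_n,
    inner c x X X = 1 -> inner c x Y Y = 1 -> inner c x X Y = 0 ->
    0 <= curv c x X Y X Y.

Definition pinched_flag_curvature (lambda : R) : Prop :=
  forall (x : M) (c : chart R n M), atlas c -> cdom c x ->
  forall e : 'rV[R]_n, e != 0 ->
  forall X Y : 'rV[R]_n,
    inner c x e X = 0 -> inner c x e Y = 0 ->
    Num.sqrt (inner c x X X) = Num.sqrt (inner c x Y Y) ->
    lambda * flag_form c x e Y Y <= flag_form c x e X X.

(* The order of R[i] is partial: 0 <= z means that z is real and >= 0. *)
Definition nonneg_complex_sectional_curvature : Prop :=
  forall (x : M) (c : chart R n M), atlas c -> cdom c x ->
  forall U V : 'rV[R[i]]_n,
    0 <= curvC c x U V (conj_vec U) (conj_vec V).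

End Curvature.

(* Main.v *)
(* Write a complex plane as the span of X + iY and Z + iW with X, Y, Z, W pairwise
   orthogonal: a unitary basis of the plane can be rotated so as to diagonalize the
   complex bilinear extension of the metric, and a change of phase then makes the
   diagonal entries real.  By the pair symmetry and the first Bianchi identity,
   nonnegativity on this plane is the inequality
     2 R(X,Y,Z,W) <= K(X,Z) + K(X,W) + K(Y,Z) + K(Y,W),  K(A,B) = R(A,B,A,B).
   With X, Y, Z, W = x1 e1, x2 e2, x3 e3, x4 e4 for orthonormal e1, .., e4, follow
   Berger: by the Bianchi identity, 3 R1234 is the sum of the polarizations
   R(e1,e2,e3,e4) + R(e3,e2,e1,e4) and - R(e1,e2,e4,e3) - R(e4,e2,e1,e3), and these are
   controlled by the pinching of the flags e = x1 e1 +- x2 e3, tested on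
   x3 e2 -+ x4 e4 and -+ x4 e2 - x3 e4, and e = x1 e1 +- x2 e4, tested on
   x4 e2 +- x3 e3 and +- x3 e2 - x4 e3.  The remaining K12 and K34 are absorbed by
   K12 <= 4 K13, 4 K14 and K34 <= 4 K23, 4 K24. *)

Require Import Defs.
From mathcomp Require Import all_boot all_order all_algebra.
From mathcomp Require Import all_classical all_reals.
From mathcomp Require Import topology normedtype derive.
From mathcomp Require Import complex ring lra.

Set Implicit Arguments.
Unset Strict Implicit.
Unset Printing Implicit Defensive.

Import Order.TTheory GRing.Theory Num.Theory.
Import numFieldTopology.Exports numFieldNormedType.Exports.

Local Open Scope ring_scope.

(** * Curvature-like tensors *)

Section Multilinear.
Variables (K : comPzRingType) (n : nat).
Implicit Types (T : 'I_n -> 'I_n -> 'I_n -> 'I_n -> K) (U V W Z : 'rV[K]_n).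

Lemma eq_multilin4 T T' : (forall i j k l, T i j k l = T' i j k l) ->
  forall U V W Z, multilin4 T U V W Z = multilin4 T' U V W Z.
Proof.
move=> e U V W Z; do 4![apply: eq_bigr => ? _].
by rewrite e.
Qed.

Lemma multilin4DT T T' U V W Z :
  multilin4 (fun i j k l => T i j k l + T' i j k l) U V W Z =
  multilin4 T U V W Z + multilin4 T' U V W Z.
Proof.
rewrite /multilin4; do 4![rewrite -big_split; apply: eq_bigr => ? _ /=].
by rewrite !mulrDl.
Qed.

Lemma multilin4NT T U V W Z :
  multilin4 (fun i j k l => - T i j k l) U V W Z = - multilin4 T U V W Z.
Proof.
rewrite /multilin4; do 4![rewrite -sumrN; apply: eq_bigr => ? _ /=].
by rewrite !mulNr.
Qed.

Lemma multilin4_swap12 T U V W Z :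
  multilin4 T U V W Z = multilin4 (fun i j => T j i) V U W Z.
Proof.
rewrite /multilin4 exchange_big /=; do 4![apply: eq_bigr => ? _].
by rewrite -!mulrA; congr (_ * _); rewrite mulrCA.
Qed.

Lemma multilin4_swap23 T U V W Z :
  multilin4 T U V W Z = multilin4 (fun i j k => T i k j) U W V Z.
Proof.
rewrite /multilin4; apply: eq_bigr => ? _; rewrite exchange_big /=.
do 3![apply: eq_bigr => ? _].
by rewrite -!mulrA; do 2!congr (_ * _); rewrite mulrCA.
Qed.

Lemma multilin4_swap34 T U V W Z :
  multilin4 T U V W Z = multilin4 (fun i j k l => T i j l k) U V Z W.
Proof.
rewrite /multilin4; do 2![apply: eq_bigr => ? _]; rewrite exchange_big /=.
do 2![apply: eq_bigr => ? _].
by rewrite -!mulrA; do 3!congr (_ * _); rewrite mulrC.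
Qed.

Lemma multilin4D1 T U U' V W Z :
  multilin4 T (U + U') V W Z = multilin4 T U V W Z + multilin4 T U' V W Z.
Proof.
rewrite /multilin4; do 4![rewrite -big_split; apply: eq_bigr => ? _ /=].
by rewrite mxE mulrDr !mulrDl.
Qed.

Lemma multilin4Z1 T a U V W Z :
  multilin4 T (a *: U) V W Z = a * multilin4 T U V W Z.
Proof.
rewrite /multilin4; do 4![rewrite mulr_sumr; apply: eq_bigr => ? _ /=].
by rewrite mxE; ring.
Qed.

Lemma multilin4_0 T V W Z : multilin4 T 0 V W Z = 0.
Proof. by rewrite -(scale0r 0) multilin4Z1 mul0r. Qed.

End Multilinear.

Section CurvatureLike.
Variables (K : comPzRingType) (n : nat).
Variable T : 'I_n -> 'I_n -> 'I_n -> 'I_n -> K.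

(** The algebraic symmetries of a curvature tensor, over any commutative ring so that one calculus
    serves both the real tensor and its complex linear extension. *)
Record curvature_like : Prop := CurvatureLike {
  curvature_anti : forall i j k l, T i j k l = - T j i k l;
  curvature_pair : forall i j k l, T i j k l = T k l i j;
  curvature_bianchi : forall i j k l, T i j k l + T j k i l + T k i j l = 0
}.

Hypothesis cT : curvature_like.
Local Notation Rm := (multilin4 T).
Implicit Types (U V W Z : 'rV[K]_n).

Lemma curv_anti12 U V W Z : Rm U V W Z = - Rm V U W Z.
Proof.
rewrite multilin4_swap12 -multilin4NT; apply: eq_multilin4 => i j k l.
exact: curvature_anti.
Qed.

Lemma curv_pair U V W Z : Rm U V W Z = Rm W Z U V.
Proof.
rewrite multilin4_swap23 multilin4_swap12 multilin4_swap34 multilin4_swap23.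
by apply: eq_multilin4 => i j k l; rewrite (curvature_pair cT).
Qed.

Lemma curv_anti34 U V W Z : Rm U V W Z = - Rm U V Z W.
Proof. by rewrite curv_pair curv_anti12 curv_pair. Qed.

Lemma curv_bianchi U V W Z : Rm U V W Z + Rm V W U Z + Rm W U V Z = 0.
Proof.
rewrite (multilin4_swap23 _ V) (multilin4_swap12 _ V).
rewrite (multilin4_swap12 _ W) (multilin4_swap23 _ U W).
rewrite -!multilin4DT (eq_multilin4 (T' := fun _ _ _ _ => 0)); last first.
  by move=> i j k l; rewrite -[RHS](curvature_bianchi cT i j k l); ring.
by rewrite /multilin4 !big1 // => i _; rewrite !big1 // => j _;
  rewrite !big1 // => k _; rewrite !big1 // => l _; rewrite !mul0r.
Qed.

Lemma curvD2 U V V' W Z : Rm U (V + V') W Z = Rm U V W Z + Rm U V' W Z.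
Proof. by rewrite 3!(curv_anti12 U) multilin4D1 opprD. Qed.
Lemma curvZ2 a U V W Z : Rm U (a *: V) W Z = a * Rm U V W Z.
Proof. by rewrite 2!(curv_anti12 U) multilin4Z1 mulrN. Qed.
Lemma curvD3 U V W W' Z : Rm U V (W + W') Z = Rm U V W Z + Rm U V W' Z.
Proof. by rewrite 3!(curv_pair U) multilin4D1. Qed.
Lemma curvZ3 a U V W Z : Rm U V (a *: W) Z = a * Rm U V W Z.
Proof. by rewrite 2!(curv_pair U) multilin4Z1. Qed.
Lemma curvD4 U V W Z Z' : Rm U V W (Z + Z') = Rm U V W Z + Rm U V W Z'.
Proof. by rewrite 3!(curv_pair U) curvD2. Qed.
Lemma curvZ4 a U V W Z : Rm U V W (a *: Z) = a * Rm U V W Z.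
Proof. by rewrite 2!(curv_pair U) curvZ2. Qed.

Lemma curv0_2 U W Z : Rm U 0 W Z = 0.
Proof. by rewrite curv_anti12 multilin4_0 oppr0. Qed.

Definition curv_linE :=
  (multilin4D1, multilin4Z1, curvD2, curvZ2, curvD3, curvZ3, curvD4, curvZ4).

End CurvatureLike.

(** * Symmetric bilinear forms given by a matrix *)

Section Bilinear.
Variables (K : comPzRingType) (n : nat) (G : 'M[K]_n).
Hypothesis Gsym : G^T = G.
Definition mxform (X Y : 'rV[K]_n) : K := (X *m G *m Y^T) 0 0.
Local Notation "<< X , Y >>" := (mxform X Y).

Lemma mxformC X Y : <<X, Y>> = <<Y, X>>.
Proof.
rewrite /mxform; have -> : X *m G *m Y^T = (Y *m G *m X^T)^T.
  by rewrite !trmx_mul trmxK Gsym mulmxA.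
by rewrite mxE.
Qed.

Lemma mxformDl X X' Y : <<X + X', Y>> = <<X, Y>> + <<X', Y>>.
Proof. by rewrite /mxform !mulmxDl mxE. Qed.
Lemma mxformZl a X Y : <<a *: X, Y>> = a * <<X, Y>>.
Proof. by rewrite /mxform -!scalemxAl mxE. Qed.
Lemma mxformDr X Y Y' : <<X, Y + Y'>> = <<X, Y>> + <<X, Y'>>.
Proof. by rewrite 3!(mxformC X) mxformDl. Qed.
Lemma mxformZr a X Y : <<X, a *: Y>> = a * <<X, Y>>.
Proof. by rewrite 2!(mxformC X) mxformZl. Qed.

Definition mxform_linE := (mxformDl, mxformZl, mxformDr, mxformZr).
End Bilinear.

(** * Berger's estimate on real orthogonal quadruples *)

Section Real.
Variables (R : rcfType) (n : nat).
Variable T : 'I_n -> 'I_n -> 'I_n -> 'I_n -> R.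
Variable G : 'M[R]_n.
Hypothesis cT : curvature_like T.
Hypothesis Gsym : G^T = G.
Hypothesis Gpos : forall v : 'rV[R]_n, v != 0 -> 0 < mxform G v v.
Local Notation Rm := (multilin4 T).
Local Notation "<< X , Y >>" := (mxform G X Y).
Hypothesis hsec : forall X Y, <<X, X>> = 1 -> <<Y, Y>> = 1 -> <<X, Y>> = 0 ->
  0 <= Rm X Y X Y.
Hypothesis hflag : forall e : 'rV[R]_n, e != 0 -> forall X Y,
  <<e, X>> = 0 -> <<e, Y>> = 0 -> <<X, X>> = <<Y, Y>> -> 4^-1 * Rm e Y e Y <= Rm e X e X.

Lemma mxform0 X : <<X, 0>> = 0.
Proof. by rewrite -(scale0r X) (mxformZr Gsym) mul0r. Qed.

Lemma mxform_neq0 v c : <<v, v>> = c -> c != 0 -> v != 0.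
Proof. by move=> <-; apply: contra_neq => ->; rewrite mxform0. Qed.

Lemma unit_vector v : v != 0 ->
  exists x u, [/\ x != 0, v = x *: u & <<u, u>> = 1].
Proof.
move=> v0; have p := Gpos v0.
have s0 : Num.sqrt <<v, v>> != 0 by rewrite gt_eqF // sqrtr_gt0.
exists (Num.sqrt <<v, v>>), ((Num.sqrt <<v, v>>)^-1 *: v); split => //.
  by rewrite scalerA divff // scale1r.
rewrite !(mxform_linE Gsym) mulrA -invfM -expr2 sqr_sqrtr ?ltW //.
by rewrite mulVf // gt_eqF.
Qed.

(** By homogeneity: normalizing the two vectors divides the curvature by the square of the product
    of their lengths. *)
Lemma sec_ge0 X Y : <<X, Y>> = 0 -> 0 <= Rm X Y X Y.
Proof.
move=> o.
have [->|] := eqVneq X 0; first by rewrite multilin4_0.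
move=> /unit_vector[x [X' [x0 eX uX]]]; subst X.
have [->|] := eqVneq Y 0; first by rewrite (curv0_2 cT).
move=> /unit_vector[y [Y' [y0 eY uY]]]; subst Y.
move: o => /eqP; rewrite !(mxform_linE Gsym) !mulf_eq0 (negbTE x0) (negbTE y0) /=.
move=> /eqP o; rewrite !(curv_linE cT).
have -> r : x * (y * (x * (y * r))) = (x * y) ^+ 2 * r by ring.
by rewrite mulr_ge0 ?sqr_ge0 // hsec.
Qed.

(** The pinching compares aX + bY with bX - aY, which have equal length and are orthogonal to e.
    After multiplication by 4 the mixed terms 8ab and 2ab add up to 10ab. *)
Lemma flag_matrix e X Y a b : e != 0 -> <<e, X>> = 0 -> <<e, Y>> = 0 -> <<X, Y>> = 0 ->
  <<X, X>> = <<Y, Y>> ->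
  0 <= (4 * a ^+ 2 - b ^+ 2) * Rm e X e X + 10 * (a * b) * Rm e X e Y
    + (4 * b ^+ 2 - a ^+ 2) * Rm e Y e Y.
Proof.
move=> e0 eX eY XY nXY.
have := hflag e0 (X := a *: X + b *: Y) (Y := b *: X + (- a) *: Y).
rewrite !(mxform_linE Gsym) eX eY (mxformC Gsym Y X) XY nXY !(curv_linE cT).
rewrite (curv_pair cT e Y e X) => H.
have {}H := H ltac:(ring) ltac:(ring) ltac:(ring).
by lra.
Qed.

(** Separating the lengths from the directions makes the final inequality polynomial in the lengths
    and linear in the curvatures. [x1 != 0] keeps all the flag vectors nonzero. *)
Lemma quarter_pinched_orthonormal e1 e2 e3 e4 (x1 x2 x3 x4 : R) :
  <<e1, e1>> = 1 -> <<e2, e2>> = 1 -> <<e3, e3>> = 1 -> <<e4, e4>> = 1 ->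
  <<e1, e2>> = 0 -> <<e1, e3>> = 0 -> <<e1, e4>> = 0 ->
  <<e2, e3>> = 0 -> <<e2, e4>> = 0 -> <<e3, e4>> = 0 ->
  x1 != 0 ->
  2 * (x1 * x2 * x3 * x4) * Rm e1 e2 e3 e4 <=
    x1 ^+ 2 * x3 ^+ 2 * Rm e1 e3 e1 e3 + x1 ^+ 2 * x4 ^+ 2 * Rm e1 e4 e1 e4 +
    x2 ^+ 2 * x3 ^+ 2 * Rm e2 e3 e2 e3 + x2 ^+ 2 * x4 ^+ 2 * Rm e2 e4 e2 e4.
Proof.
move=> n1 n2 n3 n4 o12 o13 o14 o23 o24 o34 x10.
have E13 (s : R) : x1 *: e1 + (s * x2) *: e3 != 0.
  apply: (mxform_neq0 erefl).
  rewrite !(mxform_linE Gsym) (mxformC Gsym e3 e1) n1 n3 o13.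
  suff : 0 < x1 ^+ 2 by nra.
  by rewrite exprn_even_gt0.
have E14 (s : R) : x1 *: e1 + (s * x2) *: e4 != 0.
  apply: (mxform_neq0 erefl).
  rewrite !(mxform_linE Gsym) (mxformC Gsym e4 e1) n1 n4 o14.
  suff : 0 < x1 ^+ 2 by nra.
  by rewrite exprn_even_gt0.
have nz e : <<e, e>> = 1 -> e != 0.
  by move=> h; apply: (mxform_neq0 h); rewrite oner_eq0.
(* The flags are e = x1 e1 + s x2 e3 and e = x1 e1 + s x2 e4, with s = 1 and s = -1. *)
have A s := @flag_matrix (x1 *: e1 + (s * x2) *: e3) e2 e4 x3 (- s * x4) (E13 s).
have B s := @flag_matrix (x1 *: e1 + (s * x2) *: e4) e2 e3 x4 (s * x3) (E14 s).
have o21 : <<e2, e1>> = 0 by rewrite mxformC.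
have o31 : <<e3, e1>> = 0 by rewrite mxformC.
have o41 : <<e4, e1>> = 0 by rewrite mxformC.
have o32 : <<e3, e2>> = 0 by rewrite mxformC.
have o42 : <<e4, e2>> = 0 by rewrite mxformC.
have o43 : <<e4, e3>> = 0 by rewrite mxformC.
have h13 := hflag (nz _ n1) o13 o12 (etrans n3 (esym n2)).
have h14 := hflag (nz _ n1) o14 o12 (etrans n4 (esym n2)).
have h23 := hflag (nz _ n3) o32 o34 (etrans n2 (esym n4)).
have h24 := hflag (nz _ n4) o42 o43 (etrans n2 (esym n3)).
have {}A s := A s ltac:(by rewrite !(mxform_linE Gsym) o12 o32 !mulr0 addr0)
 ltac:(by rewrite !(mxform_linE Gsym) o14 o34 !mulr0 addr0) o24 (etrans n2 (esym n4)).
have {}B s := B s ltac:(by rewrite !(mxform_linE Gsym) o12 o42 !mulr0 addr0)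
 ltac:(by rewrite !(mxform_linE Gsym) o13 o43 !mulr0 addr0) o23 (etrans n2 (esym n3)).
(* Adding the cases s = 1 and s = -1 cancels the terms odd in s, such as R(e1,e2,e3,e2). *)
have A1 := A 1; have A2 := A (-1); have B1 := B 1; have B2 := B (-1).
move: A1 A2 B1 B2 {A B}; rewrite !(curv_linE cT).
have p a b : Rm a b b a = - Rm a b a b by exact: curv_anti34.
have q a b : Rm b a b a = Rm a b a b by rewrite curv_anti12 // p opprK.
rewrite (q e2 e3) (q e2 e4) in h23 h24 *.
rewrite (q e3 e4) in h24.
rewrite (q e3 e4).
have t1 : Rm e3 e2 e1 e4 = Rm e1 e4 e3 e2 by exact: curv_pair.
have t2 : Rm e4 e2 e1 e3 = Rm e1 e3 e4 e2 by exact: curv_pair.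
have t3 : Rm e1 e2 e4 e3 = - Rm e1 e2 e3 e4 by exact: curv_anti34.
have t4 : Rm e1 e4 e3 e2 = - Rm e1 e4 e2 e3 by exact: curv_anti34.
(* Bianchi leaves only R(e1,e2,e3,e4) and R(e1,e3,e4,e2) among the terms with four distinct vectors;
   the second cancels between the A and the B inequalities. *)
have t5 : Rm e1 e2 e3 e4 + Rm e1 e3 e4 e2 + Rm e1 e4 e2 e3 = 0.
  have r a b c d : Rm a b c d = Rm d c b a.
    by rewrite curv_pair // curv_anti12 // curv_anti34 // opprK.
  have := curv_bianchi cT e4 e3 e2 e1.
  by rewrite (r e4) (r e3) (r e2); lra.
have {}t5 : Rm e1 e4 e2 e3 = - Rm e1 e2 e3 e4 - Rm e1 e3 e4 e2 by lra.
rewrite t1 t2 t3 t4 t5 => A1 A2 B1 B2.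
(* Together the flag inequalities leave 3 (x3^2 + x4^2) (x1^2 K12 + x2^2 K34) to absorb;
   the weights 11 and 1 add up to 12 = 4 * 3. *)
have pos (a b c K : R) : 4^-1 * a <= K -> 0 <= (11 * b ^+ 2 + c ^+ 2) * (K - 4^-1 * a).
  by move=> h; apply: mulr_ge0; [nra|lra].
have C13 := pos _ (x1 * x3) (x1 * x4) _ h13.
have C14 := pos _ (x1 * x4) (x1 * x3) _ h14.
have C23 := pos _ (x2 * x3) (x2 * x4) _ h23.
have C24 := pos _ (x2 * x4) (x2 * x3) _ h24.
(* The flags give K13 the coefficient x1^2 (4 x3^2 - x4^2); the weight x1^2 (11 x3^2 + x4^2) raises
   it to 15 x1^2 x3^2, against 30 x1 x2 x3 x4 R1234. The other three curvatures behave alike. *)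
by lra.
Qed.

(** If R(X,Y,Z,W) vanishes, nonnegative sectional curvature suffices. Otherwise all four vectors are
    nonzero and can be normalized. *)
Lemma quarter_pinched_orthogonal X Y Z W :
  <<X, Y>> = 0 -> <<X, Z>> = 0 -> <<X, W>> = 0 ->
  <<Y, Z>> = 0 -> <<Y, W>> = 0 -> <<Z, W>> = 0 ->
  2 * Rm X Y Z W <=
    Rm X Z X Z + Rm X W X W + Rm Y Z Y Z + Rm Y W Y W.
Proof.
move=> oXY oXZ oXW oYZ oYW oZW.
have pos := (sec_ge0 oXZ, sec_ge0 oXW, sec_ge0 oYZ, sec_ge0 oYW).
have [R0|] := eqVneq (Rm X Y Z W) 0.
  by rewrite R0 mulr0 !addr_ge0 // pos.
move=> R0.
have X0 : X != 0 by apply: contra_neq R0 => ->; rewrite multilin4_0.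
have Y0 : Y != 0 by apply: contra_neq R0 => ->; rewrite (curv0_2 cT).
have Z0 : Z != 0 by apply: contra_neq R0 => ->; rewrite (curv_pair cT) multilin4_0.
have W0 : W != 0 by apply: contra_neq R0 => ->; rewrite (curv_pair cT) (curv0_2 cT).
have [x1 [e1 [x10 eX n1]]] := unit_vector X0.
have [x2 [e2 [x20 eY n2]]] := unit_vector Y0.
have [x3 [e3 [x30 eZ n3]]] := unit_vector Z0.
have [x4 [e4 [x40 eW n4]]] := unit_vector W0.
have orth (a b : R) u v : a != 0 -> b != 0 -> <<a *: u, b *: v>> = 0 -> <<u, v>> = 0.
  move=> a0 b0 /eqP; rewrite !(mxform_linE Gsym) !mulf_eq0 (negbTE a0) (negbTE b0).
  by move=> /eqP.
subst X Y Z W.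
have := quarter_pinched_orthonormal x2 x3 x4 n1 n2 n3 n4 (orth _ _ _ _ x10 x20 oXY)
  (orth _ _ _ _ x10 x30 oXZ) (orth _ _ _ _ x10 x40 oXW) (orth _ _ _ _ x20 x30 oYZ)
  (orth _ _ _ _ x20 x40 oYW) (orth _ _ _ _ x30 x40 oZW) x10.
by rewrite !(curv_linE cT); lra.
Qed.

End Real.

(** * Complex planes *)

Section Complexified.
Local Open Scope complex_scope.
Variables (R : realType) (n : nat).
Variable T : 'I_n -> 'I_n -> 'I_n -> 'I_n -> R.
Variable G : 'M[R]_n.
Hypothesis cT : curvature_like T.
Hypothesis Gsym : G^T = G.
Local Notation TC := (fun i j k l => (T i j k l)%:C).
Local Notation cv := (map_mx (real_complex R)).
Local Notation Rm := (multilin4 T).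
Local Notation RmC := (multilin4 TC).
Local Notation GC := (cv G).

Lemma curvature_like_complex : curvature_like TC.
Proof.
split=> [i j k l|i j k l|i j k l].
- by rewrite (curvature_anti cT) rmorphN.
- by rewrite (curvature_pair cT).
- by rewrite -!rmorphD (curvature_bianchi cT).
Qed.

Lemma multilin4_real X Y Z W : RmC (cv X) (cv Y) (cv Z) (cv W) = (Rm X Y Z W)%:C.
Proof.
rewrite /multilin4; do 4![rewrite rmorph_sum; apply: eq_bigr => ? _ /=].
by rewrite !mxE !rmorphM.
Qed.

Lemma mxform_real X Y : mxform GC (cv X) (cv Y) = (mxform G X Y)%:C.
Proof. by rewrite /mxform map_trmx -!map_mxM mxE. Qed.

Definition cvec (X Y : 'rV[R]_n) : 'rV[R[i]]_n := cv X + 'i *: cv Y.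

Lemma cvecE U : U = cvec (map_mx (@complex.Re R) U) (map_mx (@complex.Im R) U).
Proof. by apply/rowP=> j; rewrite !mxE -complexE. Qed.

Lemma conj_vecD (U V : 'rV[R[i]]_n) : conj_vec (U + V) = conj_vec U + conj_vec V.
Proof. by apply/rowP=> j; rewrite !mxE rmorphD. Qed.

Lemma conj_vecZ a (U : 'rV[R[i]]_n) : conj_vec (a *: U) = conjc a *: conj_vec U.
Proof. by apply/rowP=> j; rewrite !mxE rmorphM. Qed.

Lemma conj_cvec X Y : conj_vec (cvec X Y) = cv X + (- 'i) *: cv Y.
Proof.
have cv_conj Z : conj_vec (cv Z) = cv Z.
  by apply/rowP=> j; rewrite mxE [in LHS]mxE conjc_real mxE.
rewrite conj_vecD conj_vecZ !cv_conj; congr (_ + _ *: _).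
by apply/eqP; rewrite eq_complex /= oppr0 !eqxx.
Qed.

Lemma GC_sym : GC^T = GC.
Proof. by rewrite map_trmx Gsym. Qed.

(** The wedge of the two vectors is (X∧Z - Y∧W) + i(X∧W + Y∧Z). The imaginary part cancels by pair
    symmetry, and the cross terms 2R(X,W,Y,Z) - 2R(X,Z,Y,W) equal -2R(X,Y,Z,W) by Bianchi. *)
Lemma curvC_cvec X Y Z W :
  RmC (cvec X Y) (cvec Z W) (conj_vec (cvec X Y)) (conj_vec (cvec Z W)) =
  (Rm X Z X Z + Rm X W X W + Rm Y Z Y Z + Rm Y W Y W - 2 * Rm X Y Z W)%:C.
Proof.
rewrite !conj_cvec /cvec !(curv_linE curvature_like_complex) !multilin4_real.
have p a b c d : Rm a b c d = Rm c d a b by exact: curv_pair.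
have B : Rm X Z Y W = Rm X Y Z W + Rm X W Y Z.
  have := curv_bianchi cT X Z Y W.
  rewrite (curv_anti12 cT Z Y) (p Y Z X W) (curv_anti12 cT Y X); lra.
apply/eqP; rewrite eq_complex /=; apply/andP; split; apply/eqP; simpc => /=.
  rewrite (p Y W X Z) (p Y Z X W) B; ring.
rewrite (p X W X Z) (p Y Z X Z) (p Y W X W) (p Y W Y Z); ring.
Qed.

Lemma mxform_conj_cvec X Y Z W : mxform GC (cvec X Y) (conj_vec (cvec Z W)) =
  (mxform G X Z + mxform G Y W) +i* (mxform G Y Z - mxform G X W).
Proof.
rewrite conj_cvec /cvec !(mxform_linE GC_sym) !mxform_real.
by apply/eqP; rewrite eq_complex /=; apply/andP; split; apply/eqP; simpc => /=; ring.
Qed.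

Lemma mxform_cvec X Y Z W : mxform GC (cvec X Y) (cvec Z W) =
  (mxform G X Z - mxform G Y W) +i* (mxform G Y Z + mxform G X W).
Proof.
rewrite /cvec !(mxform_linE GC_sym) !mxform_real.
by apply/eqP; rewrite eq_complex /=; apply/andP; split; apply/eqP; simpc => /=; ring.
Qed.


(** * Reduction of a complex plane to a basis with orthogonal real and imaginary parts *)

Hypothesis Gpos : forall v : 'rV[R]_n, v != 0 -> 0 < mxform G v v.
Hypothesis hsec : forall X Y, mxform G X X = 1 -> mxform G Y Y = 1 ->
  mxform G X Y = 0 -> 0 <= Rm X Y X Y.
Hypothesis hflag : forall e : 'rV[R]_n, e != 0 -> forall X Y,
  mxform G e X = 0 -> mxform G e Y = 0 -> mxform G X X = mxform G Y Y ->
  4^-1 * Rm e Y e Y <= Rm e X e X.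

Local Notation b := (mxform GC).
Local Notation h U V := (mxform GC U (conj_vec V)).
Local Notation F U V := (RmC U V (conj_vec U) (conj_vec V)).

Lemma hermC (U V : 'rV[R[i]]_n) : h V U = conjc (h U V).
Proof.
rewrite (cvecE U) (cvecE V).
move: (map_mx _ U) (map_mx (@complex.Im R) U) (map_mx _ V) (map_mx (@complex.Im R) V).
move=> X Y Z W; rewrite !mxform_conj_cvec /= opprB.
by rewrite (mxformC Gsym Z) (mxformC Gsym W Y) (mxformC Gsym Z) (mxformC Gsym W).
Qed.

Lemma herm_gt0 (U : 'rV[R[i]]_n) : U != 0 -> 0 < h U U.
Proof.
move=> U0; rewrite (cvecE U) mxform_conj_cvec.
set X := map_mx _ U; set Y := map_mx (@complex.Im R) U.
rewrite (mxformC Gsym Y) subrr complexr0 ltcR.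
have ge0 Z : 0 <= mxform G Z Z.
  by have [->|/Gpos/ltW//] := eqVneq Z 0; rewrite (mxform0 Gsym).
rewrite lt0r addr_ge0 // andbT; apply: contra U0.
rewrite paddr_eq0 // => /andP[XX YY].
have z Z : mxform G Z Z == 0 -> Z = 0.
  by move=> /eqP ZZ; apply/eqP; apply: contraT => /Gpos; rewrite ZZ ltxx.
by rewrite (cvecE U) -/X -/Y (z _ XX) (z _ YY) /cvec !raddf0 addr0.
Qed.

Lemma unit_vectorC (U : 'rV[R[i]]_n) : U != 0 ->
  exists x : R[i], x != 0 /\ h (x *: U) (x *: U) = 1.
Proof.
move=> /herm_gt0 hU.
suff [x x0 hx] : exists2 x : R[i], x != 0 & x * (conjc x * h U U) = 1.
  by exists x; split => //; rewrite conj_vecZ !(mxform_linE GC_sym).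
move: hU; case: (h U U) => r s; rewrite ltcE /= => /andP[/eqP -> r0].
have q0 : Num.sqrt r != 0 by rewrite gt_eqF ?sqrtr_gt0.
exists ((Num.sqrt r)^-1)%:C.
  by rewrite eq_complex /= eqxx andbT invr_eq0.
rewrite conjc_real complexr0 -!rmorphM mulrA -invfM -expr2 sqr_sqrtr ?ltW //.
by rewrite mulVf ?gt_eqF.
Qed.

(** For U = X + iY and V = Z + iW, the vanishing of h(U,V) and b(U,V) makes X, Y orthogonal to Z, W,
    while Im b(U,U) = 2<X,Y> and Im b(V,V) = 2<Z,W>. *)
Lemma curvC_orthogonal_ge0 U V : h U V = 0 -> b U V = 0 ->
  complex.Im (b U U) = 0 -> complex.Im (b V V) = 0 -> 0 <= F U V.
Proof.
rewrite (cvecE U) (cvecE V).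
move: (map_mx _ U) (map_mx (@complex.Im R) U) (map_mx _ V) (map_mx (@complex.Im R) V).
move=> X Y Z W; rewrite !mxform_cvec mxform_conj_cvec curvC_cvec => -[h1 h2] [b1 b2] /=.
rewrite (mxformC Gsym Y X) (mxformC Gsym W Z) => oXY oZW.
by rewrite ler0c subr_ge0 (quarter_pinched_orthogonal cT Gsym Gpos) //; lra.
Qed.

(** F depends only on U∧V, which a change of basis multiplies by its determinant. *)
Lemma curvC_lincomb p q r s U V :
  F (p *: U + q *: V) (r *: U + s *: V) =
  (p * s - q * r) * conjc (p * s - q * r) * F U V.
Proof.
rewrite !conj_vecD !conj_vecZ !(curv_linE curvature_like_complex).
move: (conj_vec U) (conj_vec V) => U' V'.
have z A B C : RmC A A B C = 0.
  have /eqP := curv_anti12 curvature_like_complex A A B C.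
  by rewrite -addr_eq0 -mulr2n mulrn_eq0 => /eqP.
have z' A B C : RmC A B C C = 0.
  by rewrite curv_pair ?z //; exact: curvature_like_complex.
rewrite !z !z' !(curv_anti12 curvature_like_complex V U).
rewrite !(curv_anti34 curvature_like_complex _ _ V' U').
rewrite rmorphB !rmorphM /=; ring.
Qed.

Lemma conjc_mul_gt0 (x : R[i]) : x != 0 -> 0 < x * conjc x.
Proof. by move=> x0; rewrite lt0r mulcJ_ge0 mulf_neq0 // conjc_eq0. Qed.

Lemma curvC_lincomb_ge0 p q r s U V : p * s - q * r != 0 ->
  (0 <= F (p *: U + q *: V) (r *: U + s *: V)) = (0 <= F U V).
Proof. by move=> det0; rewrite curvC_lincomb pmulr_rge0 // conjc_mul_gt0. Qed.

(* If a, c, d are the values b(U,U), b(U,V), b(V,V) of a symmetric bilinear form, the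
   root z makes U + z V and V - z^* U orthogonal for b.  Multiplied by c^* the equation
   becomes real along a suitable real line of z's, where it is a quadratic equation with
   nonnegative discriminant. *)
Lemma takagi_rotation (a c d : R[i]) :
  exists z, d * z - a * conjc z + c * (1 - z * conjc z) = 0.
Proof.
have [->|c0] := eqVneq c 0; first by exists 0; rewrite !conjc0; ring.
pose k := conjc c * d + c * conjc a.
have [w w0 kw] : exists2 w, w != 0 & conjc (k * w) = k * w.
  have [k0|k0] := eqVneq k 0.
    by exists 1; rewrite ?oner_eq0 // k0 mul0r conjc0.
  by exists (conjc k); rewrite ?conjc_eq0 // rmorphM /= conjcK mulrC.
have [t et] : exists t : R, conjc c * (d * w - a * conjc w) = t%:C.
  have : conjc (conjc c * (d * w - a * conjc w)) = conjc c * (d * w - a * conjc w).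
    move: kw; rewrite /k !(rmorphM, rmorphB, rmorphD) /= !conjcK => kw.
    by apply/eqP; rewrite -subr_eq0; apply/eqP; move/eqP: kw;
      rewrite -subr_eq0 => /eqP kw; rewrite -kw; ring.
  case: (_ * _) => x y [] /eqP; rewrite -subr_eq0 -opprD oppr_eq0 -mulr2n.
  by rewrite mulrn_eq0 /= => /eqP ->; exists x.
have [m m0 em] : exists2 m : R, 0 < m & w * conjc w = m%:C.
  have := conjc_mul_gt0 w0; case: (_ * _) => x y; rewrite ltcE /= => /andP[/eqP ->].
  by exists x.
have [B B0 eB] : exists2 B : R, 0 < B & c * conjc c = B%:C.
  have := conjc_mul_gt0 c0; case: (_ * _) => x y; rewrite ltcE /= => /andP[/eqP ->].
  by exists x.
(* For z = r w with r real, the equation times c^* reads r t + B (1 - r^2 m) = 0; D is its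
   discriminant and [r] its larger root. *)
pose D := t ^+ 2 + 4 * B ^+ 2 * m.
have D0 : 0 <= D by rewrite /D; nra.
pose r := (t + Num.sqrt D) / (2 * B * m).
have er : r * t + B * (1 - r ^+ 2 * m) = 0.
  have /eqP := sqr_sqrtr D0; rewrite -subr_eq0 {2}/D => /eqP sD.
  have -> : r * t + B * (1 - r ^+ 2 * m) =
    - (Num.sqrt D ^+ 2 - (t ^+ 2 + 4 * B ^+ 2 * m)) / (4 * B * m).
    by rewrite /r; field; rewrite !gt_eqF.
  by rewrite sD oppr0 mul0r.
exists (r%:C * w).
have -> : conjc (r%:C * w) = r%:C * conjc w.
  by rewrite rmorphM; congr (_ * _); exact: conjc_real.
have cc0 : conjc c != 0 by rewrite conjc_eq0.
apply: (mulfI cc0); rewrite mulr0.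
transitivity (r%:C * (conjc c * (d * w - a * conjc w)) +
  c * conjc c * (1 - r%:C ^+ 2 * (w * conjc w))); first by ring.
by rewrite et em eB -rmorphXn -!rmorphM -(rmorph1 (real_complex R)) -rmorphB
  -rmorphM -rmorphD /= er.
Qed.

(** A square root of x^* turns x into |x|^2. It serves to make b(cU,cU) = c^2 b(U,U) real. *)
Lemma real_phase (x : R[i]) : exists2 c : R[i], c != 0 & complex.Im (c ^+ 2 * x) = 0.
Proof.
have [->|x0] := eqVneq x 0; first by exists 1; rewrite ?oner_eq0 // mulr0.
exists (sqrtc (conjc x)); first by rewrite sqrtc_eq0 conjc_eq0.
rewrite sqr_sqrtc mulrC; apply: ger0_Im; exact: mulcJ_ge0.
Qed.

Lemma curvC_ge0 U V : 0 <= F U V.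
Proof.
have l0 A B : F A B = 0 -> 0 <= F A B by move=> ->.
have [->|U0] := eqVneq U 0.
  by apply: l0; rewrite multilin4_0.
(* Gram-Schmidt for h, a change of basis of determinant 1. If the new vector is zero, the plane is
   degenerate and F vanishes. *)
pose V1 := - (h V U / h U U) *: U + 1 *: V.
have hUU := herm_gt0 U0; have hUU0 : h U U != 0 by rewrite gt_eqF.
have <- : (0 <= F U V1) = (0 <= F U V).
  have := @curvC_lincomb_ge0 1 0 (- (h V U / h U U)) 1 U V.
  by rewrite scale1r scale0r addr0 mul0r subr0 mul1r oner_eq0 => /(_ isT).
have hVU : h V1 U = 0.
  by rewrite /V1 !(mxform_linE GC_sym) mulNr divfK // mul1r addNr.
move: V1 hVU => {}V hVU.
have [->|V0] := eqVneq V 0.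
  by apply: l0; rewrite (curv0_2 curvature_like_complex).
have hVV := herm_gt0 V0; have hVV0 : h V V != 0 by rewrite gt_eqF.
have hUV : h U V = 0 by rewrite hermC hVU conjc0.
have [x [x0 U1]] := unit_vectorC U0; have [y [y0 V1]] := unit_vectorC V0.
have [z ez] := takagi_rotation
  (b (x *: U) (x *: U)) (b (x *: U) (y *: V)) (b (y *: V) (y *: V)).
(* For every z this pair stays h-orthogonal, since [x *: U] and [y *: V] are h-orthonormal; the
   equation for z says b(u,v) = 0. *)
pose u := x *: U + (z * y) *: V; pose v := - (conjc z * x) *: U + y *: V.
have [p p0 pu] := real_phase (b u u); have [q q0 qv] := real_phase (b v v).
have hxy : h (x *: U) (y *: V) = 0.
  by rewrite conj_vecZ !(mxform_linE GC_sym) hUV !mulr0.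
have hyx : h (y *: V) (x *: U) = 0.
  by rewrite conj_vecZ !(mxform_linE GC_sym) hVU !mulr0.
have eu : u = x *: U + z *: (y *: V) by rewrite /u scalerA.
have ev : v = - conjc z *: (x *: U) + y *: V by rewrite /v scalerA mulNr.
have huv : h u v = 0.
  rewrite eu ev; move: (x *: U) (y *: V) U1 V1 hxy hyx => A B AA BB AB BA.
  rewrite conj_vecD conj_vecZ !(mxform_linE GC_sym) AA BB AB BA rmorphN /= conjcK.
  by ring.
have buv : b u v = 0.
  rewrite -[RHS]ez eu ev.
  move: (x *: U) (y *: V) => U' V'.
  rewrite !(mxform_linE GC_sym) (mxformC GC_sym V' U'); ring.
have : 0 <= F (p *: u) (q *: v).
  move: (u) (v) pu qv huv buv => A B pA qB hAB bAB; apply: curvC_orthogonal_ge0.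
  - by rewrite conj_vecZ !(mxform_linE GC_sym) hAB !mulr0.
  - by rewrite !(mxform_linE GC_sym) bAB !mulr0.
  - by rewrite !(mxform_linE GC_sym) mulrA -expr2.
  - by rewrite !(mxform_linE GC_sym) mulrA -expr2.
have lin0 (a a' : R[i]) (A B : 'rV[R[i]]_n) :
    a *: A + 0 *: B = a *: A /\ 0 *: A + a' *: B = a' *: B.
  by rewrite !scale0r addr0 add0r.
(* Back to U and V: the phases have determinant pq and the rotation xy(1 + |z|^2), both nonzero. *)
rewrite -(lin0 p q u v).1 -(lin0 p q u v).2 curvC_lincomb_ge0; last first.
  by rewrite mul0r subr0 mulf_neq0.
rewrite /u /v curvC_lincomb_ge0 //.
have -> : x * y - z * y * - (conjc z * x) = x * y * (1 + z * conjc z) by ring.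
by rewrite !mulf_neq0 // gt_eqF // ltr_pwDl // mulcJ_ge0.
Qed.

End Complexified.

(** * Symmetry of second derivatives *)

Section Schwarz.
Local Open Scope classical_set_scope.
Variables (R : realType) (V : normedModType R).
Implicit Types (f : V -> R) (y u v : V).

(** The difference quotients are the same function of h. This transfers derivatives to lines and
    translates. *)
Lemma is_derive_increment (V' : normedModType R) (g : V' -> R) (t w : V') f y v :
  (forall h, g (h *: w + t) - g t = f (h *: v + y) - f y) ->
  derivable f y v -> is_derive t w g ('D_v f y).
Proof.
move=> gf df; have E : (fun h : R => h^-1 *: ((g \o shift t) (h *: w) - g t)) =
    (fun h : R => h^-1 *: ((f \o shift y) (h *: v) - f y)).
  by apply/funext => h /=; rewrite gf.
split; first by rewrite
  (congr1 (fun F : R -> R => cvg (F @ 0^')) E : derivable g t w = _).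
exact: (congr1 (fun F : R -> R => lim (F @ 0^')) E).
Qed.

Lemma is_derive_line f y u (t : R) : derivable f (y + t *: u) u ->
  is_derive t 1 (fun s => f (y + s *: u)) ('D_u f (y + t *: u)).
Proof.
apply: is_derive_increment => h.
by rewrite [h *: 1]mulr1 scalerDl addrCA.
Qed.

Lemma MVT_line f y u (t : R) : 0 < t ->
  (forall s, 0 <= s <= t -> derivable f (y + s *: u) u) ->
  exists2 s, 0 <= s <= t & f (y + t *: u) - f y = 'D_u f (y + s *: u) * t.
Proof.
move=> t0 df.
have dl s : 0 <= s <= t -> is_derive s 1 (fun s => f (y + s *: u)) ('D_u f (y + s *: u)).
  by move=> /df /is_derive_line.
have [||s] := @MVT R (fun s => f (y + s *: u)) (fun s => 'D_u f (y + s *: u)) 0 t t0.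
- by move=> s; rewrite in_itv /= => /andP[s0 st]; apply: dl; rewrite !ltW.
- apply: derivable_within_continuous => s; rewrite in_itv /= => st.
  by have [] := dl _ st.
rewrite in_itv /= scale0r addr0 subr0 => /andP[s0 st] e.
by exists s => //; rewrite !ltW.
Qed.

(** The mean value theorem applies twice: along u to f(x + tv) - f(x), then along v to the
    derivative of f along u. *)
Lemma second_difference f y u v (t : R) : 0 < t ->
  (forall a b, 0 <= a <= t -> 0 <= b <= t ->
    derivable f (y + a *: u + b *: v) u /\ derivable ('D_u f) (y + a *: u + b *: v) v) ->
  exists a b, [/\ 0 <= a <= t, 0 <= b <= t &
    f (y + t *: u + t *: v) - f (y + t *: u) - f (y + t *: v) + f y =
    'D_v ('D_u f) (y + a *: u + b *: v) * t * t].
Proof.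
move=> t0 df; have tt : 0 <= t <= t by rewrite lexx ltW.
have t00 : 0 <= (0 : R) <= t by rewrite lexx ltW.
pose g x := f (x + t *: v) - f x.
have dg a : 0 <= a <= t -> is_derive (y + a *: u) u g
    ('D_u f (y + a *: u + t *: v) - 'D_u f (y + a *: u)).
  move=> at0; have [d1 _] := df a t at0 tt; have [d0 _] := df a 0 at0 t00.
  rewrite scale0r addr0 in d0.
  apply: is_deriveB; last exact: derivableP.
  by apply: is_derive_increment d1 => h; rewrite /= !addrA.
have [a at0 ea] := @MVT_line g y u t t0 (fun a at0 => (dg a at0).(ex_derive)).
have [b bt0 eb] := @MVT_line ('D_u f) (y + a *: u) v t t0
  (fun b bt0 => (df a b at0 bt0).2).
exists a, b; split => //.
move: ea; rewrite (dg a at0).(derive_val) eb /g => <-.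
ring.
Qed.

(** Both orders of summation occur because [second_difference] is used for (u, v) and for (v, u). *)
Lemma nbhs_square y u v (A : set V) : nbhs y A ->
  exists2 t : R, 0 < t & forall a b, 0 <= a <= t -> 0 <= b <= t ->
    A (y + a *: u + b *: v) /\ A (y + b *: v + a *: u).
Proof.
move=> /nbhs_normP[e /= e0 yA].
have k0 : 0 < `|u| + `|v| + 1 by rewrite ltr_pwDr // addr_ge0.
exists (e / (2 * (`|u| + `|v| + 1))); first by rewrite divr_gt0 // mulr_gt0.
move=> a b /andP[a0 ae] /andP[b0 be]; rewrite [y + b *: v + _]addrAC.
suff : A (y + a *: u + b *: v) by [].
apply: yA; rewrite /=.
rewrite -addrA opprD addNKr normrN (le_lt_trans (ler_normD _ _)) //.
rewrite !normrZ !ger0_norm //.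
have le x z : 0 <= x -> z <= e / (2 * (`|u| + `|v| + 1)) ->
    z * x <= e / (2 * (`|u| + `|v| + 1)) * x.
  by move=> x0 ze; rewrite ler_wpM2r.
have H := lerD (le _ _ (normr_ge0 u) ae) (le _ _ (normr_ge0 v) be).
apply: (le_lt_trans H); rewrite -mulrDr mulrAC ltr_pdivrMr ?mulr_gt0 // ltr_pM2l //.
by have := normr_ge0 u; have := normr_ge0 v; lra.
Qed.

Lemma dist_of_scaled_eq (x1 x2 z1 z2 d1 d2 t e : R) : t != 0 ->
  d1 = z1 * t * t -> d2 = z2 * t * t -> d1 = d2 ->
  `|x1 - z1| < e / 2 -> `|x2 - z2| < e / 2 -> `|x1 - x2| <= e.
Proof.
move=> t0 -> ->; do 2!move=> /(mulIf t0); move=> <- h1 h2.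
have -> : x1 - x2 = (x1 - z1) - (x2 - z1) by ring.
by apply: (le_trans (ler_normB _ _)); rewrite (splitr e) lerD // ltW.
Qed.

(** The second difference is symmetric in u and v, so the two mixed derivatives agree at two points
    of a small parallelogram; by continuity their values at y differ by at most any e > 0. *)
Lemma schwarz f y u v :
  (\forall x \near y, derivable f x u /\ derivable f x v) ->
  (\forall x \near y, derivable ('D_u f) x v /\ derivable ('D_v f) x u) ->
  {for y, continuous ('D_v ('D_u f))} -> {for y, continuous ('D_u ('D_v f))} ->
  'D_v ('D_u f) y = 'D_u ('D_v f) y.
Proof.
move=> d1 d2 c1 c2; apply/eqP; rewrite -subr_eq0 -normr_le0.
apply/ler_addgt0Pl => e e0; rewrite addr0.
have e2 : 0 < e / 2 by rewrite divr_gt0.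
have /cvgrPdist_lt/(_ _ e2) c1' := c1; have /cvgrPdist_lt/(_ _ e2) c2' := c2.
have [t t0 sq] := nbhs_square u v (filterI (filterI d1 d2) (filterI c1' c2')).
have [|a [b [at0 bt0 E1]]] := @second_difference f y u v t t0.
  by move=> a b at0 bt0; have [[[[? ?] [? ?]] _] _] := sq a b at0 bt0.
have [|b' [a' [bt0' at0' E2]]] := @second_difference f y v u t t0.
  by move=> b' a' bt0' at0'; have [_ [[[? ?] [? ?]] _]] := sq a' b' at0' bt0'.
have [[_ [F1 _]] _] := sq _ _ at0 bt0; have [_ [_ [_ F2]]] := sq _ _ at0' bt0'.
apply: (dist_of_scaled_eq _ E1 E2 _ F1 F2); first by rewrite gt_eqF.
have -> : y + t *: v + t *: u = y + t *: u + t *: v by exact: addrAC.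
by congr (_ + _); rewrite -!addrA; congr (_ + _); exact: addrC.
Qed.

End Schwarz.

(** * Symmetries of the curvature of a metric *)

Section DerivableMatrix.
Local Open Scope classical_set_scope.
Variables (R : realType) (V : normedModType R) (y v : V).

Lemma derivable_bigsum (I : Type) (r : seq I) (P : pred I) (f : I -> V -> R) :
  (forall i, derivable (f i) y v) -> derivable (fun z => \sum_(i <- r | P i) f i z) y v.
Proof.
move=> df; elim: r => [|i r IH].
  by under eq_fun do rewrite big_nil; exact: derivable_cst.
under eq_fun do rewrite big_cons; case: (P i); last exact: IH.
exact: (derivableD (df i) IH).
Qed.

Lemma derivable_bigprod (I : Type) (r : seq I) (P : pred I) (f : I -> V -> R) :
  (forall i, derivable (f i) y v) -> derivable (fun z => \prod_(i <- r | P i) f i z) y v.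
Proof.
move=> df; elim: r => [|i r IH].
  by under eq_fun do rewrite big_nil; exact: derivable_cst.
under eq_fun do rewrite big_cons; case: (P i); last exact: IH.
exact: (derivableM (df i) IH).
Qed.

Lemma derivable_det n (A : V -> 'M[R]_n) :
  (forall i j, derivable (fun z => A z i j) y v) -> derivable (fun z => \det (A z)) y v.
Proof.
move=> dA; rewrite /determinant; apply: derivable_bigsum => s.
apply: derivableM; first exact: derivable_cst.
by apply: derivable_bigprod => i; exact: dA.
Qed.

Lemma derivable_invmx n (A : V -> 'M[R]_n) :
  (\forall z \near y, A z \in unitmx) ->
  (forall i j, derivable (fun z => A z i j) y v) ->
  forall i j, derivable (fun z => invmx (A z) i j) y v.
Proof.
move=> uA dA i j.
(* Cramer's formula, valid only near y: on a singular matrix [invmx] is the identity. *)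
apply: (near_eq_derivable (f := fun z => (\det (A z))^-1 * cofactor (A z) j i)).
  by apply: filterS uA => z uz; rewrite /invmx uz !mxE.
have dety : \det (A y) != 0 by have := nbhs_singleton uA; rewrite unitmxE unitfE.
apply: derivableM; first by apply: derivableV => //; exact: derivable_det.
rewrite /cofactor; apply: derivableM; first exact: derivable_cst.
apply: derivable_det => k l.
by under eq_fun do rewrite !mxE; exact: dA.
Qed.

Lemma is_derive_bigsum n (h : 'I_n -> V -> R) (dh : 'I_n -> R) :
  (forall i, is_derive y v (h i) (dh i)) ->
  is_derive y v (fun z => \sum_(i < n) h i z) (\sum_(i < n) dh i).
Proof.
move=> H; have -> : (fun z => \sum_(i < n) h i z) = \sum_(i < n) h i.
  by apply/funext => z; rewrite fct_sumE.
exact: is_derive_sum.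
Qed.

End DerivableMatrix.

(* D i j k l stands for the second derivative d_i d_j g_kl, and B i j k l for the inner
   product of the vectors nabla_{d_i} d_j and nabla_{d_k} d_l. *)
Lemma curvature_like_of_hessian (K : comPzRingType) n (c : K)
    (D B T : 'I_n -> 'I_n -> 'I_n -> 'I_n -> K) :
  (forall i j k l, D i j k l = D j i k l) -> (forall i j k l, D i j k l = D i j l k) ->
  (forall i j k l, B i j k l = B j i k l) -> (forall i j k l, B i j k l = B k l i j) ->
  (forall i j k l, T i j k l =
     c * (D i l j k - D i k j l - D j l i k + D j k i l) - B i k j l + B j k i l) ->
  curvature_like T.
Proof.
move=> D12 D34 B12 Bp TE.
have B34 i j k l : B i j k l = B i j l k by rewrite Bp B12 Bp.
split=> i j k l; rewrite !TE; first by ring.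
  rewrite (D12 k j) (D34 _ _ l i) (D12 k i) (D34 _ _ l j) (D12 l j) (D34 _ _ k i).
  rewrite (D12 l i) (D34 _ _ k j) (B12 k i) (B34 _ _ l j) (Bp l i)
    (B12 k j) (B34 _ _ l i).
  by ring.
rewrite (D34 j l k i) (D12 j i) (D34 k l j i) (D12 k i j) (D12 k j i) (D34 i l k j).
by rewrite (B12 j i) (B12 k i) (B12 k j) (Bp i j k l); ring.
Qed.

(** * Christoffel symbols and curvature coefficients in a chart *)

Section MetricCurvature.
Local Open Scope classical_set_scope.
Variables (R : realType) (n : nat) (U : set 'rV[R]_n) (G : 'rV[R]_n -> 'M[R]_n).
Hypothesis openU : open U.
Hypothesis smoothG : forall i j, smooth_on U (fun z => G z i j).
Hypothesis symG : forall z, U z -> (G z)^T = G z.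
Hypothesis unitG : forall z, U z -> G z \in unitmx.

Local Notation dG k i j := (partial k (fun z => G z i j)).
Local Notation d2G k l i j := (partial k (dG l i j)).
Local Notation Gam := (christoffel G).

(** Christoffel symbol of the first kind, the inner product of nabla_{d_i} d_j with d_p. *)
Definition christoffel1 (p i j : 'I_n) (z : 'rV[R]_n) : R :=
  2^-1 * (dG i j p z + dG j i p z - dG p i j z).

Lemma near_U z : U z -> \forall x \near z, U x.
Proof. by move=> Uz; exact: open_nbhs_nbhs. Qed.

Lemma eq_partial k (f h : 'rV[R]_n -> R) z : U z -> (forall x, U x -> f x = h x) ->
  partial k f z = partial k h z.
Proof. by move=> /near_U Uz fh; apply: near_eq_derive; apply: filterS Uz. Qed.

Lemma dG_sym k i j z : U z -> dG k i j z = dG k j i z.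
Proof. by move=> Uz; apply: eq_partial => // x /symG Gx; rewrite -[in LHS]Gx mxE. Qed.

Lemma d2G_sym k l i j z : U z -> d2G k l i j z = d2G k l j i z.
Proof. by move=> Uz; apply: eq_partial => // x; exact: dG_sym. Qed.

Lemma d2G_comm k l i j z : U z -> d2G k l i j z = d2G l k i j z.
Proof.
move=> Uz; apply: schwarz.
- apply: filterS (near_U Uz) => x Ux.
  by have [_ d] := smoothG i j [::] Ux; split; exact: d.
- apply: filterS (near_U Uz) => x Ux.
  by split; [exact: (smoothG i j [:: l] Ux).2 | exact: (smoothG i j [:: k] Ux).2].
- exact: (smoothG i j [:: k; l] Uz).1.
- exact: (smoothG i j [:: l; k] Uz).1.
Qed.

Lemma derivable_G i j k z : U z -> derivable (fun z => G z i j) z (delta_mx 0 k).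
Proof. by move=> Uz; exact: (smoothG i j [::] Uz).2. Qed.

Lemma is_derive_dG l i j k z : U z ->
  is_derive z (delta_mx 0 k) (dG l i j) (d2G k l i j z).
Proof. by move=> Uz; apply: derivableP; exact: (smoothG i j [:: l] Uz).2. Qed.

Lemma is_derive_christoffel1 p i j k z : U z ->
  is_derive z (delta_mx 0 k) (christoffel1 p i j)
    (2^-1 * (d2G k i j p z + d2G k j i p z - d2G k p i j z)).
Proof.
move=> Uz; apply: is_deriveZ; apply: is_deriveB; last exact: is_derive_dG.
by apply: is_deriveD; exact: is_derive_dG.
Qed.

Lemma christoffelE m i j z :
  Gam m i j z = \sum_(p < n) invmx (G z) m p * christoffel1 p i j z.
Proof. by rewrite /christoffel mulr_sumr; apply: eq_bigr => p _; rewrite mulrCA. Qed.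

Lemma christoffel_lower k i j z : U z ->
  \sum_(m < n) G z k m * Gam m i j z = christoffel1 k i j z.
Proof.
move=> Uz; pose c : 'cV[R]_n := \col_p christoffel1 p i j z.
have -> : christoffel1 k i j z = c k 0 by rewrite mxE.
rewrite -[c](mulKVmx (unitG Uz)) mxE; apply: eq_bigr => m _; congr (_ * _).
by rewrite christoffelE mxE; apply: eq_bigr => p _; rewrite mxE.
Qed.

Lemma derivable_christoffel m i j k z : U z -> derivable (Gam m i j) z (delta_mx 0 k).
Proof.
move=> Uz; rewrite (_ : Gam m i j =
    fun z => \sum_(p < n) invmx (G z) m p * christoffel1 p i j z).
  apply: derivable_bigsum => p; apply: derivableM.
    apply: derivable_invmx => [|a b]; last exact: derivable_G.
    by apply: filterS (near_U Uz) => x; exact: unitG.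
  by have [] := is_derive_christoffel1 p i j k Uz.
by apply/funext => x; exact: christoffelE.
Qed.

(** Differentiating the lowered identity by the product rule avoids computing the derivative of the
    inverse matrix. *)
Lemma christoffel_lower_partial a k i j z : U z ->
  \sum_(m < n) G z k m * partial a (Gam m i j) z =
  2^-1 * (d2G a i j k z + d2G a j i k z - d2G a k i j z)
   - \sum_(m < n) dG a k m z * Gam m i j z.
Proof.
move=> Uz; rewrite -(is_derive_christoffel1 k i j a Uz).(derive_val).
have -> : 'D_(delta_mx 0 a) (christoffel1 k i j) z =
    partial a (fun x => \sum_(m < n) G x k m * Gam m i j x) z.
  by apply: eq_partial => // x Ux; rewrite christoffel_lower.
have D : is_derive z (delta_mx 0 a) (fun x => \sum_(m < n) G x k m * Gam m i j x)
  (\sum_(m < n) (G z k m * partial a (Gam m i j) z + Gam m i j z * dG a k m z)).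
  apply: is_derive_bigsum => m; apply: is_deriveM.
    exact/derivableP/derivable_G.
  exact/derivableP/derivable_christoffel.
rewrite /partial D.(derive_val) big_split /= -addrA.
by rewrite [X in _ + X](_ : _ = 0) ?addr0 // -sumrB big1 // => m _; rewrite mulrC subrr.
Qed.

(** The inner product of nabla_{d_i} d_j and nabla_{d_k} d_l. *)
Definition christoffel_prod (z : 'rV[R]_n) (i j k l : 'I_n) : R :=
  \sum_(m < n) christoffel1 m i j z * Gam m k l z.

Lemma christoffel1_sym p i j z : U z -> christoffel1 p i j z = christoffel1 p j i z.
Proof. by move=> Uz; rewrite /christoffel1 (dG_sym p i j Uz) [dG i j p z + _]addrC. Qed.

Lemma christoffel_prodC z i j k l : U z ->
  christoffel_prod z i j k l = christoffel_prod z k l i j.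
Proof.
move=> Uz; rewrite /christoffel_prod.
under eq_bigr do rewrite christoffelE mulr_sumr.
under [RHS]eq_bigr do rewrite christoffelE mulr_sumr.
rewrite exchange_big /=; apply: eq_bigr => p _; apply: eq_bigr => m _.
have -> : invmx (G z) m p = invmx (G z) p m.
  by rewrite -[in LHS](symG Uz) -trmx_inv mxE.
ring.
Qed.

Lemma curv_coefE z i j k l : U z ->
  curv_coef G z i j k l =
  2^-1 * (d2G i l j k z - d2G i k j l z - d2G j l i k z + d2G j k i l z)
  - christoffel_prod z i k j l + christoffel_prod z j k i l.
Proof.
move=> Uz.
have E (a b : 'I_n) : \sum_(m < n) G z k m * (\sum_(q < n) Gam q b l z * Gam m a q z)
    = \sum_(q < n) christoffel1 k a q z * Gam q b l z.
  under eq_bigr do rewrite mulr_sumr.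
  rewrite exchange_big /=; apply: eq_bigr => q _.
  rewrite -christoffel_lower // mulr_suml; apply: eq_bigr => m _; ring.
(* Metric compatibility: d_a g_km is the sum of [christoffel1 k a m] and [christoffel1 m a k]. *)
have S a b : \sum_(q < n) christoffel1 k a q z * Gam q b l z -
    \sum_(m < n) dG a k m z * Gam m b l z = - christoffel_prod z a k b l.
  rewrite -sumrB /christoffel_prod -sumrN; apply: eq_bigr => m _.
  rewrite -mulrBl -mulNr; congr (_ * _); rewrite /christoffel1.
  by rewrite (dG_sym a m k Uz) (dG_sym k a m Uz) (dG_sym m a k Uz)
    (dG_sym k m a Uz); field.
transitivity (\sum_(m < n) G z k m * partial i (Gam m j l) z
  - \sum_(m < n) G z k m * partial j (Gam m i l) z
  + (\sum_(m < n) G z k m * (\sum_(q < n) Gam q j l z * Gam m i q z)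
  - \sum_(m < n) G z k m * (\sum_(q < n) Gam q i l z * Gam m j q z))).
  rewrite -!sumrB -big_split; apply: eq_bigr => m _ /=.
  by rewrite /riemann sumrB mulrDr !mulrBr.
(* Linear arithmetic on abstract reals; a = a' is the commutation of d_i and d_j on g_lk. *)
have pure (L1 L2 M1 M2 a a' a2 a3 b2 b3 D1 D2 Q1 Q2 P1 P2 : R) :
    L1 = 2^-1 * (a + a2 - a3) - D1 -> L2 = 2^-1 * (a' + b2 - b3) - D2 -> a = a' ->
    M1 = Q1 -> M2 = Q2 -> Q1 - D1 = - P1 -> Q2 - D2 = - P2 ->
    L1 - L2 + (M1 - M2) = 2^-1 * (a2 - a3 - b2 + b3) - P1 + P2.
  by move=> -> -> -> -> ->; lra.
exact: (pure _ _ _ _ _ _ _ _ _ _ _ _ _ _ _ _ (christoffel_lower_partial i k j l Uz)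
  (christoffel_lower_partial j k i l Uz) (d2G_comm i j l k Uz) (E i j) (E j i)
  (S i j) (S j i)).
Qed.

Lemma curvature_like_curv_coef z : U z -> curvature_like (curv_coef G z).
Proof.
move=> Uz.
apply: (@curvature_like_of_hessian _ _ 2^-1 (fun i j k l => d2G i j k l z)
  (christoffel_prod z)) => i j k l.
- exact: d2G_comm.
- exact: d2G_sym.
- by apply: eq_bigr => m _; rewrite christoffel1_sym.
- exact: christoffel_prodC.
- exact: curv_coefE.
Qed.

End MetricCurvature.

(** * From the manifold to the algebraic statement at a point *)

Theorem theorem1p1 (R : realType) (n : nat) (M : smoothManifold R n)
    (g : riemannianMetric M)
    (hsec : nonneg_sectional_curvature g)
    (hflag : pinched_flag_curvature g (4^-1)) :
  nonneg_complex_sectional_curvature g.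
Proof.
move=> x c hc hx U V.
have cx := coord_cod hx.
(* A nonzero kernel vector would contradict positive definiteness. *)
have unitG y : ccod c y -> gram g c y \in unitmx.
  move=> hy; rewrite unitmxE unitfE; apply/negP => /det0P[v v0 vG].
  by have := gram_pos g hc hy v0; rewrite vG mul0mx mxE ltxx.
apply: (@curvC_ge0 R n (curv_coef (gram g c) (c x)) (gram g c (c x))).
- apply: (curvature_like_curv_coef (@ccod_open _ _ _ c)) => //.
  + by move=> i j; exact: gram_smooth.
  + by move=> y; exact: gram_sym.
- exact: gram_sym.
- by move=> v; exact: gram_pos.
- by move=> X Y; exact: hsec.
- move=> e e0 X Y eX eY XY.
  by apply: (hflag x c hc hx e e0 X Y eX eY); congr Num.sqrt.
Qed.
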